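(* Let $S$ be a $k$-stellated $d$-sphere which is not the standard $d$-sphere $S^d_{d+2}$. Then $S$ is at most $k$-neighbourly (that is, $S$ is not $(k+1)$-neighbourly).
   Context: All simplicial complexes are finite and abstract, with the empty set as a face. For a finite set $\alpha$, $\overline{\alpha}$ is the complex of all subsets of $\alpha$ and $\partial\alpha$ the complex of all proper subsets; $\dim\alpha=\#\alpha-1$. The join $X\ast Y$ (disjoint vertex sets) has as faces the disjoint unions of a face of $X$ and a face of $Y$. The standard sphere $S^d_{d+2}$ is $\partial\alpha$ with $\#\alpha=d+2$. Complexes are identified up to isomorphism. Bistellar moves: if $X$ is $d$-dimensional and $\alpha,\beta$ are disjoint nonempty sets with $\dim\alpha+\dim\beta=d$ such that the set of faces of $X$ contained in $\alpha\sqcup\beta$ is exactly $\overline{\alpha}\ast\partial\beta$, then $Y=(X\setminus(\overline\alpha\ast\partial\beta))\cup(\partial\alpha\ast\overline\beta)$ is obtained from $X$ by the bistellar move $\alpha\mapsto\beta$, of index $\dim\beta$ (if $\beta$ is a single vertex, it is a new vertex). For $0\le k\le d+1$, a $d$-dimensional complex is $k$-stellated if it is obtained from $S^d_{d+2}$ by a finite sequence of bistellar moves, each of index $<k$ ($S^d_{d+2}$ is the only $0$-stellated one). Such complexes are triangulated spheres. A complex $X$ is $l$-neighbourly if any $l$ vertices of $X$ form a face, i.e. $f_i(X)=\binom{f_0(X)}{i+1}$ for all $i\le l-1$, where $f_i$ is the number of $i$-dimensional faces. *)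

(* Defs.v *)
From mathcomp Require Import all_boot finmap.

Set Implicit Arguments.
Unset Strict Implicit.
Unset Printing Implicit Defensive.

Local Open Scope fset_scope.

Record complex (V : choiceType) : Type := Complex {
  faces :> {fset {fset V}};
  face0 : fset0 \in faces;
  face_sub : forall s t : {fset V}, t `<=` s -> s \in faces -> t \in faces
}.

Section Complexes.
Variable V : choiceType.
Implicit Types (X Y : complex V) (a b s : {fset V}).

Definition vertices X : {fset V} := \bigcup_(s <- faces X) s.

Definition simplex a : {fset {fset V}} := fpowerset a.
Definition boundary a : {fset {fset V}} := fpowerset a `\ a.

(* Meaningful as a join only for families on disjoint vertex sets. *)
Definition join (F G : {fset {fset V}}) : {fset {fset V}} :=
  [fset s `|` t | s in F, t in G].

Definition induced X a : {fset {fset V}} := [fset s in faces X | s `<=` a].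

(* [dim a = #a - 1]; only used for nonempty [a], since the predecessor on
   [nat] sends both 0 and 1 to 0. *)
Definition fdim a : nat := #|` a|.-1.

Definition has_dim (d : nat) X : Prop :=
  (\max_(s <- faces X) #|` s|)%N = d.+1.

Definition standard_sphere (d : nat) X : Prop :=
  exists2 a : {fset V}, #|` a| = d.+2 & faces X = boundary a.

(* When [b] is a single vertex, [boundary b] is [{fset0}] and the condition on
   [induced] already forces that vertex to be new. *)
Definition bistellar_move (d : nat) a b X Y : Prop :=
  has_dim d X /\
  [/\ a != fset0, b != fset0, [disjoint a & b]%fset & (fdim a + fdim b)%N = d] /\
  induced X (a `|` b) = join (simplex a) (boundary b) /\
  faces Y = (faces X `\` join (simplex a) (boundary b))
            `|` join (boundary a) (simplex b).

(* [Y] is obtained from [X] by finitely many moves, all of index [< k]; the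
   index of the move [a |-> b] is [dim b]. *)
Inductive bistellar_seq (d k : nat) X : complex V -> Prop :=
| bistellar_nil : bistellar_seq d k X X
| bistellar_step a b Y Z :
    bistellar_seq d k X Y -> (fdim b < k)%N -> bistellar_move d a b Y Z ->
    bistellar_seq d k X Z.

Definition neighbourly (l : nat) X : Prop :=
  forall a, a `<=` vertices X -> #|` a| = l -> a \in faces X.

End Complexes.

Definition isomorphic (V W : choiceType) (X : complex V) (Y : complex W) :=
  exists2 f : V -> W, {in vertices X &, injective f} &
    faces Y = [fset [fset f v | v in (s : {fset V})] | s in faces X].

(* Complexes are considered up to isomorphism. The moves are carried out on
   complexes with vertices in the infinite type [nat], so that a new vertex is
   always available, even when [V] is finite. *)
Definition stellated (d k : nat) (V : choiceType) (S : complex V) : Prop :=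
  exists X0 X : complex nat,
    [/\ standard_sphere d X0, bistellar_seq d k X0 X & isomorphic X S].

(* Main.v *)
(** The g-polynomial g(S) = sum over faces s of x^#s (1-x)^(d+2-#s) equals
    1 - x^(d+2) on the standard sphere, and a move a |-> b adds x^#b - x^#a to
    it, since the weights x^#s (1-x)^(n-#s) sum to 1 over the subsets of an
    n-set. When all moves have #b <= k, the coefficient of x^(k+1) is therefore
    never positive. On the other hand, if S is (k+1)-neighbourly with
    n = d+2+m vertices, the same identity gives (1-x)^m g(S) = 1 modulo
    x^(k+2), so this coefficient is positive as soon as m > 0. Finally, moves
    preserve the property that every d-set lies in an even number of facets, and
    this forces a d-dimensional complex with at most d+2 vertices to be
    standard. *)

Require Import Defs.
From mathcomp Require Import all_boot finmap.
From mathcomp Require Import all_order all_algebra.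

Set Implicit Arguments.
Unset Strict Implicit.
Unset Printing Implicit Defensive.

(** * Sums over families of subsets of a finite set *)

Section Sums.
Local Open Scope fset_scope.
Local Open Scope ring_scope.
Import Order.TTheory GRing.Theory Num.Theory.
Variable V : choiceType.
Implicit Types (a b r s t W : {fset V}) (A B F : {fset {fset V}}).

(** The second hypothesis makes [B] disjoint from what is left of [F], so nothing is counted twice.
    This is the shape of the face set after a move. *)
Lemma sum_fsetDU (M : zmodType) A B F (phi : {fset V} -> M) :
  A `<=` F -> (forall s, s \in B -> s \in F -> s \in A) ->
  \sum_(s <- (F `\` A) `|` B) phi s =
  \sum_(s <- F) phi s - \sum_(s <- A) phi s + \sum_(s <- B) phi s.
Proof.
move=> /fsubsetP sAF BFA.
rewrite (big_fsetID _ (mem B)) [\sum_(s <- F) _](big_fsetID _ (mem A)) /=.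
have -> : [fset s in F `\` A `|` B | s \in B] = B.
  by apply/fsetP=> s; rewrite !inE /=; case: (s \in B); rewrite ?orbT ?andbF.
have -> : [fset s in F | s \in A] = A.
  apply/fsetP=> s; rewrite !inE /= andbC.
  by case sA: (s \in A) => //=; rewrite sAF.
have -> : [fset s in F `\` A `|` B | s \notin B] = [fset s in F | s \notin A].
  apply/fsetP=> s; rewrite !inE /=.
  have := BFA s; case: (s \in B) => /=; rewrite ?orbF ?orbT ?andbT ?andbF.
    by case: (s \in F) => //= /(_ isT isT) ->.
  by move=> _; rewrite andbC.
by rewrite [X in _ = X + _]addrAC subrr add0r addrC.
Qed.

Lemma sum_fset_between (M : zmodType) r W (phi : {fset V} -> M) :
  r `<=` W ->
  \sum_(s <- [fset s in fpowerset W | r `<=` s]) phi s =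
  \sum_(u <- fpowerset (W `\` r)) phi (r `|` u).
Proof.
move=> rW.
have -> : [fset s in fpowerset W | r `<=` s] =
          [fset r `|` u | u in fpowerset (W `\` r)].
  apply/fsetP=> s; rewrite !inE /= fpowersetE; apply/andP/imfsetP => /= [[sW rs]|].
    exists (s `\` r); rewrite ?fpowersetE ?fsetSD // fsetUDl fsetDv fsetD0.
    exact/esym/fsetUidPr.
  case=> u; rewrite fpowersetE => uW ->; rewrite fsubsetUl fsubUset rW; split=> //.
  by apply: fsubset_trans uW _; apply: fsubsetDl.
rewrite big_imfset //= => u v; rewrite !fpowersetE !fsubsetD.
move=> /andP[_ ru] /andP[_ rv] E.
have := congr1 (fun s => s `\` r) E.
by rewrite !fsetDUl !fsetDv !fset0U (fsetDidPl _ _ ru) (fsetDidPl _ _ rv).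
Qed.

Lemma sum_fpowersetU1 (M : zmodType) x W (phi : {fset V} -> M) :
  x \notin W ->
  \sum_(s <- fpowerset (x |` W)) phi s =
  \sum_(s <- fpowerset W) phi (x |` s) + \sum_(s <- fpowerset W) phi s.
Proof.
move=> xW; rewrite (big_fsetID _ (fun s => [fset x] `<=` s)) /=.
rewrite sum_fset_between ?fsubsetUl // fsetU1K //.
congr (_ + _); apply: eq_fbigl => s; rewrite !inE /= !fpowersetE fsub1set.
by rewrite -[in RHS](fsetU1K xW) fsubsetD1 andbC.
Qed.

Lemma sum_binomial_fpowerset (R : comPzRingType) W (x y : R) :
  \sum_(s <- fpowerset W) x ^+ #|` s| * y ^+ (#|` W| - #|` s|) =
  (x + y) ^+ #|` W|.
Proof.
elim/fset1U_rect: W => [|v W vW IH].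
  by rewrite fpowerset0 big_seq_fset1 cardfs0 !expr0 mulr1.
rewrite sum_fpowersetU1 // cardfsU1 vW exprS mulrDl -IH !mulr_sumr.
congr (_ + _); apply: eq_big_seq => s; rewrite fpowersetE => sW.
  have vs : v \notin s by apply: contraNN vW; apply: (fsubsetP sW).
  by rewrite cardfsU1 vs subSS exprS mulrA.
by rewrite subSn ?fsubset_leq_card // exprS mulrCA.
Qed.

(** All subsets of [W] together weigh 1. Those containing [b] weigh [x ^+ #b] times the total weight
    of the subsets of [W] minus [b], which is again 1. *)
Lemma sum_not_above (R : comPzRingType) b W (x : R) : b `<=` W ->
  \sum_(s <- [fset s in fpowerset W | ~~ (b `<=` s)])
     x ^+ #|` s| * (1 - x) ^+ (#|` W| - #|` s|) = 1 - x ^+ #|` b|.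
Proof.
move=> bW; apply: (addrI (x ^+ #|` b|)); rewrite subrKC.
have := sum_binomial_fpowerset W x (1 - x).
rewrite subrKC expr1n (big_fsetID _ (fun s => b `<=` s)) /= => E1.
rewrite -[RHS]E1; congr (_ + _).
rewrite sum_fset_between //.
have := sum_binomial_fpowerset (W `\` b) x (1 - x).
rewrite subrKC expr1n => E.
rewrite -[LHS]mulr1 -[in LHS]E mulr_sumr; apply: eq_big_seq => u.
rewrite fpowersetE fsubsetD => /andP[uW ub]; rewrite cardfsU fsetIC.
have /eqP -> : u `&` b == fset0 by [].
by rewrite cardfs0 subn0 exprD mulrA cardfsDS // subnDA.
Qed.
End Sums.

(** * Effect of a move on sums over faces and on the g-polynomial *)

Section Moves.
Local Open Scope fset_scope.
Local Open Scope ring_scope.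
Import Order.TTheory GRing.Theory Num.Theory.
Variable V : choiceType.
Implicit Types (a b r s t W : {fset V}) (X Y : complex V).

Lemma joinC (F G : {fset {fset V}}) : join F G = join G F.
Proof.
by apply/fsetP=> s; apply/imfset2P/imfset2P => -[u uF [v vG ->]];
  exists v => //; exists u => //; rewrite fsetUC.
Qed.

Lemma join_simplex_boundary a b : [disjoint a & b]%fset ->
  join (simplex a) (boundary b) =
  [fset s in fpowerset (a `|` b) | ~~ (b `<=` s)].
Proof.
move=> dab; apply/fsetP=> s; rewrite !inE /= fpowersetE.
rewrite /simplex /boundary; apply/imfset2P/andP => /= [[u ua [v]]|[sab bs]].
  move: ua; rewrite !inE !fpowersetE => ua /andP[vb vsub] ->.
  split; first exact: fsetUSS.
  apply: contraNN vb => /fsubsetP bs; rewrite eqEfsubset vsub /=.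
  apply/fsubsetP=> x xb; have := bs x xb; rewrite inE => /orP[|//].
  by move=> /(fsubsetP ua) xa; move: (fdisjointP dab _ xa); rewrite xb.
exists (s `&` a); first by rewrite fpowersetE fsubsetIr.
exists (s `&` b); last by rewrite -fsetIUr; apply/esym/fsetIidPl.
rewrite !inE fpowersetE fsubsetIr andbT.
by apply: contraNneq bs => <-; apply: fsubsetIl.
Qed.

Lemma join_boundary_simplex a b : [disjoint a & b]%fset ->
  join (boundary a) (simplex b) =
  [fset s in fpowerset (a `|` b) | ~~ (a `<=` s)].
Proof.
move=> dab; rewrite joinC fsetUC.
by apply: join_simplex_boundary; rewrite fdisjoint_sym.
Qed.

Lemma bistellar_move_card d a b X Y : bistellar_move d a b X Y ->
  [/\ [disjoint a & b]%fset, (0 < #|` a|)%N, (0 < #|` b|)%N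
    & (#|` a| + #|` b|)%N = d.+2].
Proof.
rewrite /bistellar_move /fdim -!cardfs_gt0 => -[_ [[a0 b0 dab E] _]].
by split=> //; rewrite -E -addSn prednK // -addnS prednK.
Qed.

Lemma cardfsU_disjoint a b : [disjoint a & b]%fset ->
  #|` a `|` b| = (#|` a| + #|` b|)%N.
Proof. by move=> /eqP ab; rewrite cardfsU ab cardfs0 subn0. Qed.

Lemma sum_bistellar_move (M : zmodType) (phi : {fset V} -> M) d a b X Y :
  bistellar_move d a b X Y ->
  \sum_(s <- faces Y) phi s = \sum_(s <- faces X) phi s
   - \sum_(s <- [fset s in fpowerset (a `|` b) | ~~ (b `<=` s)]) phi s
   + \sum_(s <- [fset s in fpowerset (a `|` b) | ~~ (a `<=` s)]) phi s.
Proof.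
move=> mv; have [dab _ _ _] := bistellar_move_card mv.
case: mv => _ [_]; rewrite join_boundary_simplex // join_simplex_boundary //.
move=> [indX ->]; rewrite sum_fsetDU //.
  by rewrite -indX; apply: fset_sub.
(* An added set that was already a face lies in the subcomplex induced on [a] and [b], which is
   exactly what the move removes. *)
move=> s sB sX; rewrite -indX !inE /= sX.
by move: sB; rewrite !inE fpowersetE => /andP[].
Qed.

(** If no face has more than [d.+1] vertices, this is [1 - 'X] times the h-polynomial, so its
    coefficients are the differences of consecutive h-numbers. *)
Definition gpoly d X : {poly int} :=
  \sum_(s <- faces X) 'X^#|` s| * (1 - 'X) ^+ (d.+2 - #|` s|).

Lemma gpoly_bistellar_move d a b X Y : bistellar_move d a b X Y ->
  gpoly d Y = gpoly d X + 'X^#|` b| - 'X^#|` a|.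
Proof.
move=> mv; have [dab _ _ cab] := bistellar_move_card mv.
rewrite /gpoly (sum_bistellar_move _ mv) -cab -cardfsU_disjoint //.
rewrite !sum_not_above ?fsubsetUl ?fsubsetUr //.
by rewrite opprB !addrA subrK.
Qed.

Lemma gpoly_standard d X : standard_sphere d X -> gpoly d X = 1 - 'X^(d.+2).
Proof.
move=> [a ca]; rewrite /gpoly => ->; rewrite -ca.
rewrite -(sum_not_above _ (fsubset_refl a)).
apply: eq_fbigl => s; rewrite !inE /= fpowersetE andbC.
by case sa: (s `<=` a); rewrite //= eqEfsubset sa.
Qed.

(** * Parity of the number of facets around a ridge *)

Definition ridge_weight r s : 'F_2 :=
  ((r `<=` s) && (#|` s| == #|` r|.+1))%:R.

(** Writing the parity as a sum in ['F_2] lets [sum_bistellar_move] apply to it. *)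
Definition facet_even d X :=
  forall r, #|` r| = d -> \sum_(s <- faces X) ridge_weight r s = 0.

Lemma addrr_F2 (x : 'F_2) : x + x = 0.
Proof. by rewrite -mulr2n -mulr_natr pchar_Zp // mulr0. Qed.

(** If [r] lies in [W], exactly two sets with one more element than [r] lie between them; otherwise
    there are none. *)
Lemma sum_ridge_weight r W : #|` W| = #|` r|.+2 ->
  \sum_(s <- fpowerset W) ridge_weight r s = 0.
Proof.
move=> cW; case rW: (r `<=` W); last first.
  rewrite big1_fset // => s; rewrite fpowersetE => sW _; rewrite /ridge_weight.
  by case rs: (r `<=` s) => //; move: (fsubset_trans rs sW); rewrite rW.
rewrite (big_fsetID _ (fun s => r `<=` s)) /=.
rewrite [X in _ + X]big1_fset ?addr0 => [|s]; last first.
  rewrite !inE /= => /andP[_ /negPf rs] _.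
  by rewrite /ridge_weight rs.
rewrite sum_fset_between //.
rewrite (eq_big_seq (fun u : {fset V} => (#|` u| == 1%N)%:R)) => [|u]; last first.
  rewrite fpowersetE fsubsetD fdisjoint_sym => /andP[_ ru].
  rewrite /ridge_weight fsubsetUl cardfsU_disjoint //.
  by rewrite -[#|` r|.+1]addn1 eqn_add2l.
have : #|` W `\` r| = 2 by rewrite cardfsDS // cW -addn2 addKn.
move: (W `\` r) => U cU.
have [x xU] : exists x, x \in U by apply/fset0Pn; rewrite -cardfs_gt0 cU.
have /cardfs1P[y Uy] : #|` U `\ x| == 1%N.
  by move: cU; rewrite (cardfsD1 x) xU add1n => -[->].
have yx : x != y by have := fset11 y; rewrite -Uy !inE eq_sym; case/andP.
rewrite -(fsetD1K xU) Uy sum_fpowersetU1 ?inE //.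
rewrite fpowerset1 !big_fsetU1 ?inE ?big_seq_fset1; last 2 first.
- by apply/eqP=> /fsetP/(_ y); rewrite !inE eqxx.
- by apply/eqP=> /fsetP/(_ y); rewrite !inE eqxx.
rewrite fsetU0 cardfs2 yx !cardfs1 cardfs0 /= addr0 add0r.
exact: addrr_F2.
Qed.

(** A subset of size [d.+1] of the union of [a] and [b] omits one vertex, so it contains exactly one
    of [a] and [b]. The removed and the added facets thus partition these subsets, whose weights sum
    to 0, and modulo 2 the two parts have equal sums. *)
Lemma facet_even_bistellar_move d a b X Y :
  bistellar_move d a b X Y -> facet_even d X -> facet_even d Y.
Proof.
move=> mv evX r cr; have [dab _ _ cab] := bistellar_move_card mv.
have cW : #|` a `|` b| = d.+2 by rewrite cardfsU_disjoint.
rewrite (sum_bistellar_move _ mv) evX // sub0r.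
set A := \sum_(s <- _) _; set B := \sum_(s <- _) _.
suff <- : A = B by rewrite addNr.
have EW : B + A = 0.
  have E0 : \sum_(s <- fpowerset (a `|` b)) ridge_weight r s = 0.
    by apply: sum_ridge_weight; rewrite cW cr.
  rewrite -[RHS]E0 (big_fsetID _ (fun s => b `<=` s)) /=; congr (_ + _).
  rewrite /B -!big_fset_condE big_mkcond [RHS]big_mkcond /=.
  apply: eq_big_seq => s; rewrite fpowersetE => sW; rewrite /ridge_weight cr.
  have [cs|] := eqVneq #|` s| d.+1; last by rewrite andbF !if_same.
  suff -> : ~~ (a `<=` s) = (b `<=` s) by [].
  apply/idP/idP => [/fsubsetPn[v va vs]|bs].
    (* [s] has codimension one in [a `|` b], so it misses only [v]. *)
    suff -> : s = (a `|` b) `\ v.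
      rewrite fsubsetD1 fsubsetUr; apply: contraL va => vb.
      by move: dab; rewrite fdisjoint_sym => /fdisjointP; apply.
    apply/eqP; rewrite eqEfcard fsubsetD1 sW vs cs /= -ltnS -cW.
    by rewrite (cardfsD1 v (a `|` b)) inE va.
  apply/negP=> as_; have : a `|` b `<=` s by rewrite fsubUset as_.
  by move=> /fsubset_leq_card; rewrite cW cs ltnn.
by rewrite -[LHS]add0r -EW -addrA addrr_F2 addr0.
Qed.

(** The last two clauses say that the [d]-simplices form a nonzero cycle modulo 2. *)
Definition closed_pure d X := [/\ forall s, s \in faces X -> (#|` s| <= d.+1)%N,
  exists2 s, s \in faces X & #|` s| = d.+1 & facet_even d X].

Lemma closed_pure_standard d X : standard_sphere d X -> closed_pure d X.
Proof.
move=> [a ca Xa]; split=> [s||r cr]; rewrite Xa /boundary.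
- rewrite !inE fpowersetE => /andP[sa sub]; rewrite -ltnS -ca.
  by apply: fproper_ltn_card; rewrite fproperEneq sa.
- have [x xa] : exists x, x \in a by apply/fset0Pn; rewrite -cardfs_gt0 ca.
  have ca' := cardfsD1 x a; rewrite xa ca add1n in ca'; case: ca' => ca'.
  exists (a `\ x) => //; rewrite !inE fpowersetE fsubD1set andbT.
  by apply/eqP=> E; move: ca'; rewrite E ca => /eqP; rewrite eqn_leq ltnn andbF.
have E0 : \sum_(s <- fpowerset a) ridge_weight r s = 0.
  by apply: sum_ridge_weight; rewrite ca cr.
rewrite -[RHS]E0 [RHS](big_fsetD1 a) ?fpowersetE ?fsubset_refl //=.
by rewrite {2}/ridge_weight ca cr eqn_leq ltnn andbF add0r.
Qed.

Lemma closed_pure_bistellar_move d a b X Y :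
  bistellar_move d a b X Y -> closed_pure d X -> closed_pure d Y.
Proof.
move=> mv [smX _ evX]; have [dab a0 _ cab] := bistellar_move_card mv.
have cW : #|` a `|` b| = d.+2 by rewrite cardfsU_disjoint.
split; last exact: facet_even_bistellar_move mv evX.
all: case: mv => _ [_]; rewrite join_boundary_simplex // => -[_ ->].
  move=> s; rewrite !inE fpowersetE => /orP[/andP[_]|/andP[sW nas]].
    exact: smX.
  rewrite -ltnS -cW; apply: fproper_ltn_card; rewrite fproperE sW.
  by apply: contraNN nas; apply: fsubset_trans; apply: fsubsetUl.
(* Removing a vertex of [a] from the union leaves a set that does not contain [a], hence one of the
   added faces, of full size. *)
have [x xa] : exists x, x \in a by apply/fset0Pn; rewrite -cardfs_gt0.
exists ((a `|` b) `\ x).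
  rewrite inE; apply/orP; right.
  rewrite !inE fpowersetE fsubD1set /=; apply/fsubsetPn; exists x => //.
  by rewrite !inE eqxx.
by have := cardfsD1 x (a `|` b); rewrite inE xa cW => -[].
Qed.

(** * Complexes with at most [d.+2] vertices *)

Lemma face_sub_vertices X s : s \in faces X -> s `<=` vertices X.
Proof. by move=> sX; apply: bigfcup_sup. Qed.

(** By parity, [s] is not the only facet above the ridge [s] minus [x]; a second one supplies
    [y]. *)
Lemma facet_exchange d X s x : facet_even d X ->
  s \in faces X -> #|` s| = d.+1 -> x \in s ->
  exists2 y, y \notin s & y |` (s `\ x) \in faces X.
Proof.
move=> evX sX cs xs; pose r := s `\ x.
have cr : #|` r| = d by have := cardfsD1 x s; rewrite xs cs => -[].
have rs : r `<=` s by apply: fsubD1set.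
pose P t := (r `<=` t) && (#|` t| == d.+1).
have [/hasP[t]|/hasPn noP] := boolP (has P (faces X `\ s)).
  rewrite !inE => /andP[ts tX] /andP[rt /eqP ct].
  have /cardfs1P[y ty] : #|` t `\` r| == 1%N by rewrite cardfsDS // ct cr subSnn.
  have tE : t = y |` r.
    by rewrite -ty fsetUC fsetUDl fsetDv fsetD0; apply/esym/fsetUidPr.
  exists y; last by rewrite -tE.
  have : y \in t `\` r by rewrite ty inE.
  rewrite !inE negb_and negbK => /andP[/orP[/eqP yx|//] _].
  by move: ts; rewrite tE yx fsetD1K // eqxx.
have := evX r cr; rewrite (big_fsetD1 s) //= big1_fset => [|t tX _].
  by rewrite addr0 /ridge_weight rs cr cs eqxx.
by rewrite /ridge_weight cr -/(P t) (negPf (noP t tX)).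
Qed.

(** One exchange in a facet [s] yields a vertex [y] outside it, and [s] with [y] already exhausts
    the vertices. Every other exchange must then bring in the same [y], so all facets of the simplex
    on these vertices are present. *)
Lemma standard_sphere_few_vertices d X : closed_pure d X ->
  (#|` vertices X| <= d.+2)%N -> standard_sphere d X.
Proof.
move=> [smX [s sX cs] evX] cU.
have exch := facet_exchange evX sX cs.
have [x xs] : exists x, x \in s by apply/fset0Pn; rewrite -cardfs_gt0 cs.
have [y ys yX] := exch x xs.
have cys : #|` y |` s| = d.+2 by rewrite cardfsU1 ys cs.
have yU : y \in vertices X.
  by apply: (fsubsetP (face_sub_vertices yX)); rewrite !inE eqxx.
have sU := face_sub_vertices sX.
have UE : y |` s = vertices X.
  by apply/eqP; rewrite eqEfcard cys cU fsubUset fsub1set yU sU.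
exists (y |` s) => //; apply/fsetP=> t; rewrite /boundary !inE fpowersetE.
apply/idP/andP=> [tX|[nt tys]].
  split; last by rewrite UE face_sub_vertices.
  by apply: contraTneq (smX t tX) => ->; rewrite cys ltnn.
(* [t] omits some vertex [z]. If [z] is [y], then [t] lies in [s]; otherwise it lies in the facet
   obtained by exchanging [z] for [y]. *)
have /fsubsetPn[z] : ~~ (y |` s `<=` t).
  by apply: contra nt => yst; rewrite eqEfsubset tys.
rewrite !inE => zys zt; have [zy|zy] := eqVneq z y.
  by apply: face_sub sX; rewrite -(fsetU1K ys) fsubsetD1 tys -zy.
have zs : z \in s by move: zys; rewrite (negPf zy).
have [y' y's y'X] := exch z zs.
have y'E : y' = y.
  have : y' \in y |` s.
    by rewrite UE; apply: (fsubsetP (face_sub_vertices y'X)); rewrite !inE eqxx.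
  by rewrite !inE (negPf y's) orbF => /eqP.
apply: face_sub y'X; rewrite y'E; apply/fsubsetP=> v vt.
have := fsubsetP tys v vt; rewrite !inE => /orP[->//|->].
by rewrite andbT; apply/orP; right; apply: contraNneq zt => <-.
Qed.

(** * Neighbourliness and positive coefficients *)

Lemma fsubset_extend s U n : s `<=` U -> (#|` s| <= n <= #|` U|)%N ->
  exists t, [/\ s `<=` t, t `<=` U & #|` t| = n].
Proof.
move=> sU /andP[]; elim: n => [|n IH] sn nU.
  by exists s; split=> //; apply/eqP; rewrite -leqn0.
move: sn; rewrite leq_eqVlt => /predU1P[sn|sn]; first by exists s.
have [t [st tU ct]] := IH sn (ltnW nU).
have /fsubsetPn[x xU xt] : ~~ (U `<=` t).
  by apply: contraL nU => /fsubset_leq_card; rewrite ct -leqNgt.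
exists (x |` t); rewrite fsubUset fsub1set xU tU cardfsU1 xt ct.
by split=> //; apply: fsubsetU; rewrite st orbT.
Qed.

(** The bound on [l] excludes the case where [neighbourly l X] is vacuous. *)
Lemma neighbourly_le l X s : (l <= #|` vertices X|)%N -> neighbourly l X ->
  s `<=` vertices X -> (#|` s| <= l)%N -> s \in faces X.
Proof.
move=> lU nX sU sl.
have [|t [st tU ct]] := fsubset_extend sU (n := l); first by rewrite sl.
by apply: face_sub st _; apply: nX.
Qed.

(* The coefficients of [P] are the partial sums of those of [(1 - 'X) * P]. *)
Lemma coef_pos_of_mul_1subX (P : {poly int}) K :
  (forall i, (i <= K)%N -> 0 <= ((1 - 'X) * P)`_i) -> 0 < ((1 - 'X) * P)`_0 ->
  forall i, (i <= K)%N -> 0 < P`_i.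
Proof.
move=> P_ge0 P_gt0; elim=> [_|i IH iK].
  by move: P_gt0; rewrite mulrBl mul1r coefB coefXM subr0.
have := P_ge0 _ iK; rewrite mulrBl mul1r coefB coefXM /= subr_ge0.
by apply: lt_le_trans; apply: IH; apply: ltnW.
Qed.

Lemma coef_pos_of_mul_1subXn m (P : {poly int}) K :
  (forall i, (i <= K)%N -> 0 <= ((1 - 'X) ^+ m.+1 * P)`_i) ->
  0 < ((1 - 'X) ^+ m.+1 * P)`_0 ->
  forall i, (i <= K)%N -> 0 < P`_i.
Proof.
elim: m => [|m IH] in P *; first exact: coef_pos_of_mul_1subX.
rewrite exprSr -mulrA => P_ge0 P_gt0; have pos := IH _ P_ge0 P_gt0.
by apply: coef_pos_of_mul_1subX => [i /pos/ltW//|]; apply: pos.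
Qed.

Lemma coef_gpoly_neighbourly d l X : (l <= d.+2)%N ->
  (d.+2 < #|` vertices X|)%N -> neighbourly l X -> 0 < (gpoly d X)`_l.
Proof.
move=> ld dU nX; pose m := (#|` vertices X| - d.+3)%N.
have mE : #|` vertices X| = (m.+1 + d.+2)%N by rewrite addSnnS subnK.
suff E i : (i <= l)%N -> ((1 - 'X) ^+ m.+1 * gpoly d X)`_i = (i == 0)%:R.
  by apply: (@coef_pos_of_mul_1subXn m _ l) => [i il||//]; rewrite E // ler0n.
move=> il; have := sum_binomial_fpowerset (vertices X) 'X (1 - 'X : {poly int}).
rewrite subrKC expr1n => E1; rewrite -[RHS]coef1 -[in RHS]E1 mulr_sumr !coef_sum.
transitivity (\sum_(s <- faces X)
    ('X^#|` s| * (1 - 'X) ^+ (#|` vertices X| - #|` s|) : {poly int})`_i).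
  (* Only faces with at most [i] elements contribute, and for them [i <= l <= d.+2] keeps the
     subtraction from truncating, so the exponents add up. *)
  apply: eq_big_seq => s sX; rewrite mulrCA !coefXnM; case: ltnP => // si.
  by rewrite -exprD mE addnBA // (leq_trans si) // (leq_trans il).
apply: big_fset_incl => [|s].
  by apply/fsubsetP=> s sX; rewrite fpowersetE face_sub_vertices.
(* By neighbourliness a non-face has more than [l] elements, so it contributes nothing in degree
   [i]. *)
rewrite fpowersetE => sU sX; rewrite coefXnM ifT //.
rewrite ltnNge; apply: contra sX => si.
apply: neighbourly_le nX sU (leq_trans si il).
exact: ltnW (leq_ltn_trans ld dU).
Qed.

(** * Invariants along a sequence of moves *)

Lemma bistellar_seq_invariants d k X0 X : (k <= d.+1)%N ->
  standard_sphere d X0 -> bistellar_seq d k X0 X ->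
  closed_pure d X /\ (gpoly d X)`_k.+1 <= 0.
Proof.
move=> kd stX0; elim=> [|a b Y Z _ [cpY gY] bk mv].
  split; first exact: closed_pure_standard.
  by rewrite gpoly_standard // coefB coef1 coefXn sub0r oppr_le0 ler0n.
split; first exact: closed_pure_bistellar_move mv cpY.
have [_ _ b0 _] := bistellar_move_card mv.
rewrite (gpoly_bistellar_move mv) coefB coefD !coefXn.
(* As [b] is nonempty, index less than [k] means [#b <= k], so the positive term of the move misses
   degree [k.+1]. *)
have -> : (k.+1 == #|` b|) = false.
  by apply/negbTE; rewrite gtn_eqF // ltnS -(prednK b0).
by rewrite addr0 subr_le0 (le_trans gY) // ler0n.
Qed.

Lemma bistellar_seq_not_neighbourly d k X0 X : (k <= d.+1)%N ->
  standard_sphere d X0 -> bistellar_seq d k X0 X -> ~ standard_sphere d X ->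
  ~ neighbourly k.+1 X.
Proof.
move=> kd stX0 seqX nstX nX.
have [cpX] := bistellar_seq_invariants kd stX0 seqX.
rewrite leNgt coef_gpoly_neighbourly // ltnNge.
by apply/negP=> cU; apply/nstX/standard_sphere_few_vertices.
Qed.
End Moves.

(** * Transport along isomorphisms *)

Section Isomorphism.
Local Open Scope fset_scope.
Variables V W : choiceType.
Variables (X : complex V) (Y : complex W).

Lemma isomorphic_standard d :
  isomorphic X Y -> standard_sphere d X -> standard_sphere d Y.
Proof.
move=> [f f_inj YE] [a ca XE].
have proper_face s : s `<` a -> s \in faces X.
  by rewrite XE /boundary !inE fpowersetE fproperEneq.
(* Although [a] is not a face, its singletons are, since [#a = d.+2 >= 2]; hence [f] is injective on
   all of [a]. *)
have aU : a `<=` vertices X.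
  apply/fsubsetP=> v va.
  have vX : [fset v] \in faces X.
    by apply: proper_face; rewrite fproperEcard fsub1set va cardfs1 ca.
  by rewrite -fsub1set face_sub_vertices.
have fa_inj : {in a &, injective f}.
  by move=> u v /(fsubsetP aU) uU /(fsubsetP aU); apply: f_inj.
exists (f @` a); first by rewrite card_in_imfset.
apply/fsetP=> t; rewrite YE /boundary !inE fpowersetE.
apply/imfsetP/andP => /= [[s]|[nt ta]].
  rewrite XE /boundary !inE fpowersetE => /andP[nsa sa] ->.
  split; last first.
    apply/fsubsetP=> w /imfsetP[v /= vs ->].
    by rewrite in_imfset //= (fsubsetP sa).
  have fs_inj : {in s &, injective f}.
    by move=> u v us vs; apply: fa_inj; apply: (fsubsetP sa).
  apply: contraNneq nsa => fsa; rewrite eqEfcard sa /=.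
  have <- : #|` [fset f v | v in s]| = #|` s| by rewrite card_in_imfset.
  by rewrite fsa card_in_imfset.
have tE : t = f @` [fset v in a | f v \in t].
  apply/fsetP=> w; apply/idP/imfsetP => [wt|[v]]; last first.
    by rewrite !inE => /andP[_ ? ->].
  have /imfsetP[v /= va wE] := fsubsetP ta w wt.
  by exists v => //=; rewrite !inE va -wE.
exists [fset v in a | f v \in t] => //; apply: proper_face.
rewrite fproperEneq fset_sub andbT.
by apply: contraNneq nt => E; rewrite tE E.
Qed.

Lemma isomorphic_neighbourly l :
  isomorphic X Y -> neighbourly l Y -> neighbourly l X.
Proof.
move=> [f f_inj YE] nY a aU ca.
have fa_inj : {in a &, injective f}.
  by move=> u v /(fsubsetP aU) uU /(fsubsetP aU); apply: f_inj.
have : f @` a \in faces Y.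
  apply: nY; last by rewrite card_in_imfset.
  apply/fsubsetP=> w /imfsetP[v /= va ->].
  have /bigfcupP[s /andP[sX _] vs] := fsubsetP aU v va.
  apply/bigfcupP; exists (f @` s); last exact: in_imfset.
  by rewrite andbT YE in_imfset.
rewrite YE => /imfsetP[s /= sX E].
(* [a] and the face [s] have the same image, and injectivity on vertices places [a] inside [s]. *)
apply: face_sub (sX); apply/fsubsetP=> v va.
have : f v \in f @` s by rewrite -E in_imfset.
move=> /imfsetP[u /= us] /f_inj -> //; first exact: (fsubsetP aU).
exact: (fsubsetP (face_sub_vertices sX)).
Qed.
End Isomorphism.

Theorem corollary4p6 (V : choiceType) (d k : nat) (hk : (k <= d.+1)%N)
    (S : complex V) (hS : stellated d k S) (hstd : ~ standard_sphere d S) :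
  ~ neighbourly k.+1 S.
Proof.
have [X0 [X [stX0 seqX isoXS]]] := hS.
move=> /(isomorphic_neighbourly isoXS).
by apply: bistellar_seq_not_neighbourly seqX _ => // /(isomorphic_standard isoXS).
Qed.
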